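(* Let $\Lambda,\mu,R>0$, $\rho=\Lambda/\mu$, and $C_1,C_2\ge0$ with $\max\{C_1,C_2\}>0$. In the observable infinite-server queue there exists a unique socially optimal threshold strategy, given by $$n_s=\max\left\{N\ge 1:\ \frac{\rho\sum_{i=1}^2 C_i\left[\frac{\sum_{m=0}^{N-1}m^i\frac{\rho^m}{m!}}{\sum_{m=0}^{N}\frac{\rho^m}{m!}}-\frac{\sum_{m=0}^{N-2}m^i\frac{\rho^m}{m!}}{\sum_{m=0}^{N-1}\frac{\rho^m}{m!}}\right]}{\mathbb{E}(L_N)-\mathbb{E}(L_{N-1})}\le R\right\},$$ such that $S^r(n)$ is strictly increasing in $n$ when $n\le n_s$ and strictly decreasing in $n$ when $n>n_s$. Furthermore, $n_s$ is decreasing (in the non-strict sense) in $\rho$, with $R,C_1,C_2$ fixed.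
   Context: Customers arrive to an infinite-server system in a Poisson process of rate $\Lambda>0$; sojourn times are i.i.d. with mean $1/\mu$; $\rho=\Lambda/\mu$. A customer joining when $m$ customers are present has utility $R-(C_1m+C_2m^2)$; a balking customer has utility $0$. If all customers use threshold $n$ (join if and only if the number present is less than $n$), the system is an $M/G/n/n$ queue with stationary distribution $\mathbb{P}(N=j)=\frac{\rho^j/j!}{\sum_{k=0}^n\rho^k/k!}$, $0\le j\le n$, and expected queue length $$\mathbb{E}(L_n)=\frac{\sum_{k=0}^n k\rho^k/k!}{\sum_{k=0}^n\rho^k/k!}=\frac{\rho\sum_{k=0}^{n-1}\rho^k/k!}{\sum_{k=0}^n\rho^k/k!}.$$ Empty sums are $0$; in particular $\mathbb{E}(L_0)=0$. The expected total net gain (social welfare) per time unit under threshold $n\in\{0,1,2,\dots\}$ is $$S^r(n)=\Lambda\sum_{m=0}^{n-1}\mathbb{P}(N=m)\bigl[R-(C_1m+C_2m^2)\bigr]=\Lambda\,\frac{\sum_{m=0}^{n-1}\frac{\rho^m}{m!}\bigl[R-(C_1m+C_2m^2)\bigr]}{\sum_{k=0}^{n}\frac{\rho^k}{k!}}.$$ A threshold $n\ge1$ is called socially optimal if $S^r(n)\ge S^r(n-1)$ and $S^r(n)>S^r(n+1)$.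
   Formalization: ''Strictly increasing when n ≤ n_s'' fails if the ratio at N = n_s equals R (Λ=μ=C_1=1, C_2=0, R=4/3: n_s=2, S(1)=S(2)=2/3); the formal statement allows S(n_s−1)=S(n_s) exactly in that tie and keeps strict increase for all other pairs. *)

(* Defs.v *)
From HB Require Import structures.
From mathcomp Require Import all_boot all_order all_algebra.
From mathcomp Require Import reals.

Set Implicit Arguments.
Unset Strict Implicit.
Unset Printing Implicit Defensive.

Import Order.TTheory GRing.Theory Num.Theory.

Local Open Scope ring_scope.

Definition weight (R : realType) (rho : R) (m : nat) : R := rho ^+ m / m`!%:R.

Definition weight_sum (R : realType) (rho : R) (n : nat) : R :=
  \sum_(m < n) weight rho m.

(* P(N = j) in the M/G/n/n queue; meaningful (and only used) for j <= n. *)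
Definition stationary (R : realType) (rho : R) (n j : nat) : R :=
  weight rho j / weight_sum rho n.+1.

(* E(L_n). *)
Definition mean_queue (R : realType) (rho : R) (n : nat) : R :=
  \sum_(k < n.+1) k%:R * stationary rho n k.

(* Utility of a customer who joins when m customers are present, with service
   value r. *)
Definition utility (R : realType) (r C1 C2 : R) (m : nat) : R :=
  r - (C1 * m%:R + C2 * m%:R ^+ 2).

(* S^r(n): expected total net gain per time unit when every customer joins iff
   fewer than n customers are present. *)
Definition welfare (R : realType) (Lam mu r C1 C2 : R) (n : nat) : R :=
  Lam * \sum_(m < n) stationary (Lam / mu) n m * utility r C1 C2 m.

Definition socially_optimal (R : realType) (S : nat -> R) (n : nat) : Prop :=
  [/\ (1 <= n)%N, S n.-1 <= S n & S n.+1 < S n].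

(* For N = 1 the second sum is empty, since N.-1 = 0. *)
Definition moment_gap (R : realType) (rho : R) (i N : nat) : R :=
  (\sum_(m < N) m%:R ^+ i * weight rho m) / weight_sum rho N.+1
  - (\sum_(m < N.-1) m%:R ^+ i * weight rho m) / weight_sum rho N.

Definition marginal_ratio (R : realType) (rho C1 C2 : R) (N : nat) : R :=
  rho * (C1 * moment_gap rho 1 N + C2 * moment_gap rho 2 N)
  / (mean_queue rho N - mean_queue rho N.-1).

Definition admissible (R : realType) (rho r C1 C2 : R) : pred nat :=
  [pred N | (1 <= N)%N && (marginal_ratio rho C1 C2 N <= r)].

Definition is_maximum (A : pred nat) (n : nat) : Prop :=
  n \in A /\ forall m : nat, m \in A -> (m <= n)%N.

(* Main.v *)
Require Import Defs.
From HB Require Import structures.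
From mathcomp Require Import all_boot all_order all_algebra.
From mathcomp Require Import reals.
From mathcomp Require Import zify ring lra.

Set Implicit Arguments.
Unset Strict Implicit.
Unset Printing Implicit Defensive.

Import Order.TTheory GRing.Theory Num.Theory.

Local Open Scope ring_scope.

(** Write [f m = C1 * m + C2 * m ^ 2] and [w k = rho ^ k / k!]. By
    [welfare_step], the increment [S (n + 1) - S n] has the sign of
    [r - marginal_ratio (n + 1)]: the marginal ratio is the increase of the
    mean cost per time unit, divided by the increase of the throughput, which
    is [mu] times the mean queue length. So the theorem amounts to three
    properties of the marginal ratio: it is strictly increasing and unbounded
    in the threshold, it is at most [r] at threshold 1, and it is nondecreasing
    in [rho].

    All of them are read off from one formula, [marginal_ratioE]:
    [marginal_ratio (n + 1)] is [f n] plus the mean of the values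
    [k * (f n - f (k - 1)) / (n + 1 - k)] under weights proportional to
    [(n + 1 - k) * w k], for [k <= n]. As [f] is convex, the slopes of its
    chords increase, so these values are nondecreasing in [k] and in [n].
    The weights increase in the likelihood ratio order both when [n] increases
    and when [rho] increases. Chebyshev's sum inequality, in the form
    [le_weighted_mean], then says that the mean increases with [n]
    ([marginal_ratio_lt]) and with [rho] ([marginal_ratio_le_rho]). The term
    [f n] gives the strictness and the divergence in [n], the latter uniformly
    in [rho]; and at [n = 0] the formula gives [0], which is below [r].

    The threshold [n_s] is the last one at which the marginal ratio is at most
    [r]. The ratio is strictly below [r] before [n_s] and strictly above it
    after, so welfare increases strictly before [n_s], weakly in the step to
    [n_s], and decreases strictly from there on. *)

(** * Weighted means and likelihood ratios *)

Definition weighted_mean (R : realType) (K : nat) (p c : nat -> R) : R :=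
  (\sum_(k < K) c k * p k) / \sum_(k < K) p k.

(** Symmetrizing the double sum that expresses the difference of the two
    sides gives half the sum over all pairs [(k, l)] of
    [(c l - c k) * (q l * p k - q k * p l)], and both factors of a term have
    the same sign. *)
Lemma chebyshev_likelihood_ratio (R : realType) (K : nat) (p q c : nat -> R) :
  {homo c : k l / (k <= l)%N >-> k <= l} ->
  (forall k l, (k <= l)%N -> q k * p l <= q l * p k) ->
  (\sum_(k < K) c k * p k) * (\sum_(k < K) q k)
    <= (\sum_(k < K) c k * q k) * (\sum_(k < K) p k).
Proof.
move=> c_homo pq; rewrite -subr_ge0 !big_distrlr /=.
set X := _ - _.
have XE : X = \sum_(l < K) \sum_(k < K) c l * (q l * p k - q k * p l).
  rewrite /X -sumrB; apply: eq_bigr => l _.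
  rewrite -sumrB; apply: eq_bigr => k _; ring.
have : X + X = \sum_(l < K) \sum_(k < K)
    (c l - c k) * (q l * p k - q k * p l).
  rewrite {1}XE XE [X in _ + X]exchange_big /= -big_split /=.
  apply: eq_bigr => l _; rewrite -big_split /=; apply: eq_bigr => k _; ring.
suff : 0 <= \sum_(l < K) \sum_(k < K) (c l - c k) * (q l * p k - q k * p l).
  by move=> + XXE; rewrite -XXE; lra.
apply: sumr_ge0 => l _; apply: sumr_ge0 => k _.
have [kl|/ltnW lk] := leqP k l.
  by apply: mulr_ge0; rewrite subr_ge0 ?c_homo ?pq.
by apply: mulr_le0; rewrite subr_le0 ?c_homo ?pq.
Qed.

(** Passing to weights that are larger in the likelihood ratio order, and to
    larger values, can only increase the mean of nondecreasing values. *)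
Lemma le_weighted_mean (R : realType) (K : nat) (p q c d : nat -> R) :
  {homo c : k l / (k <= l)%N >-> k <= l} ->
  (forall k, c k <= d k) -> (forall k, 0 <= q k) ->
  (forall k l, (k <= l)%N -> q k * p l <= q l * p k) ->
  0 < \sum_(k < K) p k -> 0 < \sum_(k < K) q k ->
  weighted_mean K p c <= weighted_mean K q d.
Proof.
move=> c_homo cd q_ge0 pq p_gt0 q_gt0.
apply: (@le_trans _ _ (weighted_mean K q c)).
  rewrite /weighted_mean ler_pdivrMr// mulrAC ler_pdivlMr//.
  exact: chebyshev_likelihood_ratio.
rewrite /weighted_mean ler_pM2r ?invr_gt0//.
by apply: ler_sum => k _; apply: ler_wpM2r.
Qed.

(** * The marginal ratio as a weighted mean *)

Lemma weight_gt0 (R : realType) (rho : R) (m : nat) :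
  0 < rho -> 0 < weight rho m.
Proof. by move=> rho0; rewrite divr_gt0 ?exprn_gt0// ltr0n fact_gt0. Qed.

Lemma weightS (R : realType) (rho : R) (m : nat) :
  m.+1%:R * weight rho m.+1 = rho * weight rho m.
Proof.
rewrite /weight exprS factS natrM.
by field; rewrite nat1r !pnatr_eq0 -lt0n fact_gt0.
Qed.

Lemma weight_likelihood_ratio (R : realType) (rho1 rho2 : R) (k l : nat) :
  0 < rho1 -> rho1 <= rho2 -> (k <= l)%N ->
  weight rho2 k * weight rho1 l <= weight rho2 l * weight rho1 k.
Proof.
move=> rho1_gt0 rho12 kl; have rho2_gt0 := lt_le_trans rho1_gt0 rho12.
rewrite /weight mulrACA [leRHS]mulrACA [X in _ <= _ * X]mulrC.
apply: ler_wpM2r; first by rewrite mulr_ge0 ?invr_ge0.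
rewrite -(subnKC kl) !exprD mulrA [leRHS]mulrAC.
apply: ler_wpM2l; first by rewrite mulr_ge0 ?exprn_ge0 ?ltW.
by apply: lerXn2r; rewrite // nnegrE ltW.
Qed.

Lemma weight_sumS (R : realType) (rho : R) (n : nat) :
  weight_sum rho n.+1 = weight_sum rho n + weight rho n.
Proof. by rewrite /weight_sum big_ord_recr. Qed.

Lemma weight_sum_gt0 (R : realType) (rho : R) (n : nat) :
  0 < rho -> 0 < weight_sum rho n.+1.
Proof.
move=> rho0; rewrite /weight_sum big_ord_recr /=.
by rewrite ltr_wpDl ?weight_gt0// sumr_ge0// => i _; rewrite ltW ?weight_gt0.
Qed.

(** An index shift: the factor [k] turns the weight at [k] into [rho] times the
    weight at [k - 1]. *)
Lemma sum_weight_shift (R : realType) (rho : R) (f : nat -> R) (n : nat) :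
  \sum_(k < n.+1) k%:R * f k * weight rho k
    = rho * \sum_(k < n) f k.+1 * weight rho k.
Proof.
rewrite big_ord_recl /= !mul0r add0r mulr_sumr; apply: eq_bigr => k _.
rewrite /bump /= add1n mulrAC weightS; ring.
Qed.

Lemma mean_queueE (R : realType) (rho : R) (n : nat) :
  mean_queue rho n = rho * weight_sum rho n / weight_sum rho n.+1.
Proof.
rewrite /mean_queue /stationary /weight_sum.
have := sum_weight_shift rho (fun=> 1) n.
under eq_bigr do rewrite mulr1.
under [in RHS]eq_bigr do rewrite mul1r.
by move=> <-; rewrite mulr_suml; apply: eq_bigr => k _; rewrite mulrA.
Qed.

Definition cost (R : realType) (C1 C2 : R) (m : nat) : R :=
  C1 * m%:R + C2 * m%:R ^+ 2.

Definition cost_sum (R : realType) (rho C1 C2 : R) (n : nat) : R :=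
  \sum_(m < n) cost C1 C2 m * weight rho m.

Definition marginal_cost (R : realType) (rho C1 C2 : R) (n : nat) : R :=
  cost_sum rho C1 C2 n.+1 / weight_sum rho n.+2
    - cost_sum rho C1 C2 n / weight_sum rho n.+1.

Lemma moment_gap_cost (R : realType) (rho C1 C2 : R) (n : nat) :
  C1 * moment_gap rho 1 n.+1 + C2 * moment_gap rho 2 n.+1
    = marginal_cost rho C1 C2 n.
Proof.
have cE k : cost_sum rho C1 C2 k = C1 * \sum_(m < k) m%:R ^+ 1 * weight rho m
    + C2 * \sum_(m < k) m%:R ^+ 2 * weight rho m.
  rewrite /cost_sum !mulr_sumr -big_split; apply: eq_bigr => m _ /=.
  by rewrite /cost; ring.
rewrite /marginal_cost !cE /moment_gap /=; ring.
Qed.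

(** Since [(n + 1 - k)] counts the [j] with [k < j <= n + 1], these weights add
    up to the sum of [weight_sum rho j] over [1 <= j <= n + 1]. The truncated
    subtraction makes them vanish for [k > n]. *)
Definition triangle_weight (R : realType) (rho : R) (n k : nat) : R :=
  (n.+1 - k)%:R * weight rho k.

(** For [1 <= k <= n] this is [k] times the slope of the chord of the cost
    between [k - 1] and [n]. Its second term is a product of naturals, so that
    monotonicity is a matter of [nat]; the truncated predecessor at
    [n + k = 0] is multiplied by [k = 0]. *)
Definition scaled_slope (R : realType) (C1 C2 : R) (n k : nat) : R :=
  C1 * k%:R + C2 * (k * (n + k).-1)%:R.

Lemma triangle_weight_ge0 (R : realType) (rho : R) (n k : nat) :
  0 < rho -> 0 <= triangle_weight rho n k.
Proof. by move=> rho0; rewrite mulr_ge0 ?ler0n ?ltW ?weight_gt0. Qed.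

Lemma triangle_sum_gt0 (R : realType) (rho : R) (n K : nat) :
  0 < rho -> 0 < \sum_(k < K.+1) triangle_weight rho n k.
Proof.
move=> rho0; rewrite big_ord_recl /= ltr_wpDr//.
  by apply: sumr_ge0 => k _; apply: triangle_weight_ge0.
by apply: mulr_gt0; rewrite ?weight_gt0 // subn0 ltr0n.
Qed.

Lemma triangle_sumE (R : realType) (rho : R) (n : nat) :
  \sum_(k < n.+1) triangle_weight rho n k
    = n.+1%:R * weight_sum rho n.+1 - rho * weight_sum rho n.
Proof.
have := sum_weight_shift rho (fun=> 1) n.
under eq_bigr do rewrite mulr1.
under [in RHS]eq_bigr do rewrite mul1r.
rewrite -/(weight_sum rho n) => <-; rewrite mulr_sumr -sumrB.
apply: eq_bigr => k _; rewrite /triangle_weight natrB 1?ltnW//; ring.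
Qed.

Lemma scaled_slopeE (R : realType) (C1 C2 : R) (n k : nat) : (k <= n)%N ->
  k.+1%:R * (cost C1 C2 n - cost C1 C2 k)
    = scaled_slope C1 C2 n k.+1 * (n.+1 - k.+1)%:R.
Proof.
move=> kn; rewrite /scaled_slope /cost addnS /= subSS natrB// natrM natrD.
ring.
Qed.

Lemma scaled_slope_sumE (R : realType) (rho C1 C2 : R) (n : nat) :
  \sum_(k < n.+1) scaled_slope C1 C2 n k * triangle_weight rho n k
    = rho * (cost C1 C2 n * weight_sum rho n - cost_sum rho C1 C2 n).
Proof.
rewrite /weight_sum /cost_sum mulr_sumr -sumrB.
under [in RHS]eq_bigr do rewrite -mulrBl.
rewrite -(sum_weight_shift rho (fun k => cost C1 C2 n - cost C1 C2 k.-1)).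
apply: eq_bigr => -[[|k] /= ltkn] _.
  by rewrite /scaled_slope !mul0r !mulr0 addr0 mul0r.
by rewrite scaled_slopeE 1?ltnW// /triangle_weight mulrA.
Qed.

(** Clearing denominators, the terms [A * weight_sum rho n.+1] cancel and
    [weight rho n.+1] is a multiple of [weight rho n], which factors out. *)
Lemma normalized_sum_gapE (R : realType) (rho A c : R) (n : nat) : 0 < rho ->
  (A + c * weight rho n) / weight_sum rho n.+2 - A / weight_sum rho n.+1
    = weight rho n / (n.+1%:R * weight_sum rho n.+1 * weight_sum rho n.+2)
      * (c * (n.+1%:R * weight_sum rho n.+1) - rho * A).
Proof.
move=> rho0.
have W2 : weight_sum rho n.+2 != 0 by rewrite gt_eqF ?weight_sum_gt0.
have W1 : weight_sum rho n.+1 != 0 by rewrite gt_eqF ?weight_sum_gt0.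
have w0 : weight rho n != 0 by rewrite gt_eqF ?weight_gt0.
have N0 : n.+1%:R != 0 :> R by rewrite pnatr_eq0.
have rhoE : rho = n.+1%:R * weight rho n.+1 / weight rho n.
  by rewrite weightS mulfK.
rewrite [X in X * A]rhoE; move: W2; rewrite weight_sumS => W2.
by move: n.+1%:R (weight_sum rho n.+1) (weight rho n) (weight rho n.+1)
  N0 W1 w0 W2 {rhoE} => N W w w' N0 W1 w0 W2; field; rewrite W2 W1 w0.
Qed.

Lemma mean_queue_gapE (R : realType) (rho : R) (n : nat) : 0 < rho ->
  mean_queue rho n.+1 - mean_queue rho n
    = rho * weight rho n / (n.+1%:R * weight_sum rho n.+1 * weight_sum rho n.+2)
      * \sum_(k < n.+1) triangle_weight rho n k.
Proof.
move=> rho0; rewrite !mean_queueE triangle_sumE -!(mulrA rho) -mulrBr.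
have := normalized_sum_gapE (weight_sum rho n) 1 n rho0.
by rewrite !mul1r -weight_sumS => ->.
Qed.

Lemma mean_queue_gap_gt0 (R : realType) (rho : R) (n : nat) : 0 < rho ->
  0 < mean_queue rho n.+1 - mean_queue rho n.
Proof.
move=> rho0; rewrite mean_queue_gapE// mulr_gt0 ?triangle_sum_gt0//.
apply: divr_gt0; first exact: mulr_gt0 rho0 (weight_gt0 n rho0).
by rewrite !mulr_gt0 ?weight_sum_gt0.
Qed.

Lemma marginal_costE (R : realType) (rho C1 C2 : R) (n : nat) : 0 < rho ->
  marginal_cost rho C1 C2 n
    = weight rho n / (n.+1%:R * weight_sum rho n.+1 * weight_sum rho n.+2)
      * (cost C1 C2 n * \sum_(k < n.+1) triangle_weight rho n k
         + \sum_(k < n.+1) scaled_slope C1 C2 n k * triangle_weight rho n k).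
Proof.
move=> rho0; rewrite /marginal_cost triangle_sumE scaled_slope_sumE.
rewrite {1}/cost_sum big_ord_recr -/(cost_sum rho C1 C2 n) /=.
by rewrite normalized_sum_gapE//; congr (_ * _); ring.
Qed.

(** Subtracting [cost n] times the denominator of the marginal ratio from its
    numerator leaves, up to a factor common to both, [rho] times the sum of the
    differences [cost n - cost m] weighted by [weight m]; an index shift
    rewrites this as a sum against the very weights that form the denominator.
    The free bound [K] lets the formulas for two consecutive [n] be compared on
    one index range. *)
Lemma marginal_ratioE (R : realType) (rho C1 C2 : R) (n K : nat) :
  0 < rho -> (n <= K)%N ->
  marginal_ratio rho C1 C2 n.+1
    = cost C1 C2 n
      + weighted_mean K.+1 (triangle_weight rho n) (scaled_slope C1 C2 n).
Proof.
move=> rho0 nK.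
(* The terms beyond [n] vanish, so both sums may run up to any [K >= n]. *)
have trunc (F : nat -> R) : (forall k, (n < k)%N -> F k = 0) ->
    \sum_(k < K.+1) F k = \sum_(k < n.+1) F k.
  move=> F0; rewrite -!(big_mkord xpredT F) (big_cat_nat (n := n.+1))//=.
  rewrite -[RHS]addr0; congr (_ + _); rewrite big_nat_cond big1// => k.
  by case/andP=> /andP[nk _] _; apply: F0.
have tri0 k : (n < k)%N -> triangle_weight rho n k = 0.
  move=> nk; rewrite /triangle_weight.
  by rewrite (eqP (_ : n.+1 - k == 0)%N) ?mul0r ?subn_eq0.
rewrite /weighted_mean (trunc _ tri0).
rewrite (trunc (fun k => scaled_slope C1 C2 n k * triangle_weight rho n k));
  last by move=> k /tri0 ->; rewrite mulr0.
rewrite /marginal_ratio moment_gap_cost mean_queue_gapE//= marginal_costE//.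
have := triangle_sum_gt0 n n rho0; have := weight_gt0 n rho0.
have := weight_sum_gt0 n.+1 rho0; have := weight_sum_gt0 n rho0.
move=> /gt_eqF/negbT W1 /gt_eqF/negbT W2 /gt_eqF/negbT w0 /gt_eqF/negbT D0.
have N0 : n.+1%:R != 0 :> R by rewrite pnatr_eq0.
move: n.+1%:R N0 => N N0.
by field; rewrite W1 W2 w0 D0 N0 gt_eqF.
Qed.

(** * Monotonicity of the marginal ratio *)

Section Costs.
Variables (R : realType) (C1 C2 : R).
Hypotheses (C1_ge0 : 0 <= C1) (C2_ge0 : 0 <= C2) (C_gt0 : 0 < Num.max C1 C2).

Lemma costs_gt0 : 0 < C1 + C2.
Proof.
move: C_gt0; rewrite lt_max => /orP[C_i|C_i].
  exact: ltr_wpDr.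
exact: ltr_wpDl.
Qed.

(** Chords of the convex cost with a common right end get steeper as their left
    end moves to the right. *)
Lemma scaled_slope_homo (n : nat) :
  {homo scaled_slope C1 C2 n : k l / (k <= l)%N >-> k <= l}.
Proof.
move=> k l kl; apply: lerD; rewrite ler_wpM2l// ler_nat//.
by apply: leq_mul => //; lia.
Qed.

Lemma cost_ge (n : nat) : (C1 + C2) * n%:R <= cost C1 C2 n.
Proof.
rewrite mulrDl lerD2l ler_wpM2l// -natrX ler_nat.
by case: n => // n; rewrite expnS leq_pmulr// expn_gt0.
Qed.

Lemma cost_lt (n : nat) : cost C1 C2 n < cost C1 C2 n.+1.
Proof.
rewrite -subr_gt0.
have -> : cost C1 C2 n.+1 - cost C1 C2 n = C1 + C2 + 2 * C2 * n%:R.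
  by rewrite /cost -natr1; ring.
by rewrite ltr_wpDr ?costs_gt0// !mulr_ge0.
Qed.

Lemma marginal_ratio_ge_cost (rho : R) (n : nat) : 0 < rho ->
  cost C1 C2 n <= marginal_ratio rho C1 C2 n.+1.
Proof.
move=> rho0; rewrite (marginal_ratioE _ _ rho0 (leqnn n)) lerDl.
apply: divr_ge0; last by rewrite ltW ?triangle_sum_gt0.
apply: sumr_ge0 => k _.
by rewrite mulr_ge0 ?triangle_weight_ge0// addr_ge0 ?mulr_ge0.
Qed.

Lemma marginal_ratio1 (rho : R) : 0 < rho -> marginal_ratio rho C1 C2 1 = 0.
Proof.
move=> rho0; rewrite (marginal_ratioE _ _ rho0 (leqnn 0)).
rewrite /weighted_mean big_ord1 /cost /scaled_slope.
by rewrite !(mulr0, mul0r, expr0n, addr0).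
Qed.

(** Passing from [n] to [n + 1] increases the triangular weights in the
    likelihood ratio order, since [(n + 2 - k) / (n + 1 - k)] increases with
    [k <= n], and only the new weights charge [k = n + 1]; strictness comes
    from the cost term. *)
Lemma marginal_ratio_lt (rho : R) (n : nat) : 0 < rho ->
  marginal_ratio rho C1 C2 n.+1 < marginal_ratio rho C1 C2 n.+2.
Proof.
move=> rho0; rewrite (marginal_ratioE _ _ rho0 (leqnSn n)).
rewrite (marginal_ratioE _ _ rho0 (leqnn n.+1)) ltr_leD ?cost_lt//.
apply: le_weighted_mean; rewrite ?triangle_sum_gt0//.
- exact: scaled_slope_homo.
- move=> k; rewrite lerD2l ler_wpM2l// ler_nat.
  by apply: leq_mul => //; lia.
- by move=> k; apply: triangle_weight_ge0.
- move=> k l kl; rewrite /triangle_weight mulrACA [leRHS]mulrACA.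
  rewrite [weight rho k * _]mulrC; apply: ler_wpM2r.
    by apply: mulr_ge0; rewrite ltW// weight_gt0.
  rewrite -!natrM ler_nat; have [ln|nl] := leqP l n.+1.
    rewrite !(subSn (n := n.+1))// ?(leq_trans kl)// !mulSn.
    by rewrite [X in (_ + X <= _)%N]mulnC leq_add2r leq_sub2l.
  by rewrite (eqP (_ : n.+1 - l == 0)%N) ?muln0// subn_eq0 ltnW.
Qed.

Lemma marginal_ratio_lt_mono (rho : R) (m n : nat) : 0 < rho ->
  (0 < m < n)%N -> marginal_ratio rho C1 C2 m < marginal_ratio rho C1 C2 n.
Proof.
case: m => // m; case: n => // n rho0; rewrite ltnS => mn.
pose f k := marginal_ratio rho C1 C2 k.+1.
have f_homo : {homo f : i j / (i < j)%N >-> i < j}.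
  by apply: homo_ltn => [? ? ?|k]; [exact: lt_trans|exact: marginal_ratio_lt].
exact: f_homo.
Qed.

(** Raising [rho] tilts the weights towards large [k], which raises the mean of
    the scaled slopes. *)
Lemma marginal_ratio_le_rho (rho1 rho2 : R) (n : nat) :
  0 < rho1 -> rho1 <= rho2 ->
  marginal_ratio rho1 C1 C2 n.+1 <= marginal_ratio rho2 C1 C2 n.+1.
Proof.
move=> rho1_gt0 rho12; have rho2_gt0 := lt_le_trans rho1_gt0 rho12.
rewrite (marginal_ratioE _ _ rho1_gt0 (leqnn n)).
rewrite (marginal_ratioE _ _ rho2_gt0 (leqnn n)) lerD2l.
apply: le_weighted_mean; rewrite ?triangle_sum_gt0//.
- exact: scaled_slope_homo.
- by move=> k; apply: triangle_weight_ge0.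
- move=> k l kl; rewrite /triangle_weight mulrACA [leRHS]mulrACA.
  rewrite [X in _ <= X * _]mulrC ler_wpM2l ?mulr_ge0//.
  exact: weight_likelihood_ratio.
Qed.

End Costs.

(** * Welfare increments and the optimal threshold *)

Lemma welfare_meanE (R : realType) (Lam mu r C1 C2 : R) (n : nat) :
  welfare Lam mu r C1 C2 n
    = Lam * ((r * weight_sum (Lam / mu) n - cost_sum (Lam / mu) C1 C2 n)
             / weight_sum (Lam / mu) n.+1).
Proof.
rewrite /welfare; congr (_ * _).
have -> : r * weight_sum (Lam / mu) n - cost_sum (Lam / mu) C1 C2 n
    = \sum_(m < n) weight (Lam / mu) m * utility r C1 C2 m.
  rewrite /weight_sum /cost_sum mulr_sumr -sumrB; apply: eq_bigr => m _.
  by rewrite /utility /cost; ring.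
by rewrite mulr_suml; apply: eq_bigr => m _; rewrite /stationary mulrAC.
Qed.

(** The factor [mu * mean_queue] is the throughput, so the part in [r] is the
    additional reward; the marginal ratio is by design the additional cost per
    unit of throughput. *)
Lemma welfare_step (R : realType) (Lam mu r C1 C2 : R) (n : nat) :
  0 < Lam -> 0 < mu -> let rho := Lam / mu in
  welfare Lam mu r C1 C2 n.+1 - welfare Lam mu r C1 C2 n
    = mu * (mean_queue rho n.+1 - mean_queue rho n)
      * (r - marginal_ratio rho C1 C2 n.+1).
Proof.
move=> Lam0 mu0 rho; have rho0 : 0 < rho by rewrite divr_gt0.
have LamE : Lam = mu * rho by rewrite mulrC divfK ?gt_eqF.
have L0 : mean_queue rho n.+1 - mean_queue rho n != 0.
  by rewrite gt_eqF ?mean_queue_gap_gt0.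
rewrite /marginal_ratio moment_gap_cost -mulrA mulrBr.
rewrite [X in _ = mu * (_ - X)]mulrC divfK//.
rewrite !welfare_meanE -/rho; clearbody rho; rewrite LamE.
by rewrite !mean_queueE /marginal_cost; ring.
Qed.

Lemma lt_of_steps (R : realType) (S : nat -> R) (m n : nat) : (m < n)%N ->
  (forall k, (m <= k < n)%N -> S k < S k.+1) -> S m < S n.
Proof.
elim: n => // n IH; rewrite ltnS leq_eqVlt => /orP[/eqP->|mn] step.
  by apply: step; rewrite leqnn /=.
apply: (@lt_trans _ _ (S n)); last by apply: step; rewrite (ltnW mn) /=.
by apply: IH => // k /andP[mk kn]; apply: step; rewrite mk ltnW.
Qed.

Theorem theorem2 (R : realType) (r C1 C2 : R) (r_gt0 : 0 < r)
  (C1_ge0 : 0 <= C1) (C2_ge0 : 0 <= C2) (C_gt0 : 0 < Num.max C1 C2) :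
  exists n_s : R -> nat,
    (forall Lam mu : R, 0 < Lam -> 0 < mu ->
       let rho := Lam / mu in
       let S := welfare Lam mu r C1 C2 in
       [/\ is_maximum (admissible rho r C1 C2) (n_s rho),
           unique (socially_optimal S) (n_s rho),
           (* S is strictly increasing on [0, n_s], except that its last step
              S(n_s - 1) <= S(n_s) is an equality when the defining inequality
              of n_s is one *)
           (forall m n : nat, (m < n <= n_s rho)%N ->
              S m < S n \/
              [/\ m = (n_s rho).-1, n = n_s rho, S m = S n
                & marginal_ratio rho C1 C2 (n_s rho) = r])
         & (forall m n : nat, (n_s rho <= m < n)%N -> S n < S m)]) /\
    (forall rho1 rho2 : R, 0 < rho1 -> rho1 <= rho2 ->
       (n_s rho2 <= n_s rho1)%N).
Proof.
have C0 := costs_gt0 C1_ge0 C2_ge0 C_gt0.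
pose B := Num.bound (r / (C1 + C2)).
(* The cost of state [n] alone exceeds [r] once [n >= B], for every [rho]. *)
have adm_lt rho n : 0 < rho -> n \in admissible rho r C1 C2 -> (n < B.+1)%N.
  move=> rho0; case: n => // n; rewrite inE /= => ratio_le.
  have : n%:R <= r / (C1 + C2).
    rewrite ler_pdivlMr// mulrC (le_trans _ ratio_le)//.
    by rewrite (le_trans (cost_ge _ C2_ge0 _))// marginal_ratio_ge_cost.
  move=> nr; rewrite ltnS -(ltr_nat R).
  by rewrite (le_lt_trans nr)// archi_boundP// ltW// divr_gt0.
(* Since [B] is the same for all [rho], this bounded maximum defines [n_s]
   everywhere; it is the maximum over all thresholds when [rho > 0]. *)
pose n_s rho := (\max_(i < B.+1 | (i : nat) \in admissible rho r C1 C2) i)%N.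
have n_s_max rho : 0 < rho -> is_maximum (admissible rho r C1 C2) (n_s rho).
  move=> rho0; split; last first.
    by move=> n nA; apply: (leq_bigmax_cond (Ordinal (adm_lt _ _ rho0 nA))).
  have adm1 : 1%N \in admissible rho r C1 C2.
    by rewrite inE /= marginal_ratio1// ltW.
  rewrite /n_s (bigop.bigmax_eq_arg (Ordinal (adm_lt _ _ rho0 adm1)))//.
  by case: arg_maxnP.
exists n_s; split=> [Lam mu Lam0 mu0 rho S|rho1 rho2 rho1_gt0 rho12];
  last first.
  have [+ _] := n_s_max _ (lt_le_trans rho1_gt0 rho12).
  move=> adm; apply: (n_s_max _ rho1_gt0).2; move: adm.
  case: (n_s rho2) => // n; rewrite !inE /=; apply: le_trans.
  exact: marginal_ratio_le_rho.
have rho0 : 0 < rho by rewrite divr_gt0.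
have step n := welfare_step r C1 C2 n Lam0 mu0.
have gap0 n : 0 < mu * (mean_queue rho n.+1 - mean_queue rho n).
  by rewrite mulr_gt0// mean_queue_gap_gt0.
have step_lt n : (S n < S n.+1) = (marginal_ratio rho C1 C2 n.+1 < r).
  by rewrite -subr_gt0 step pmulr_rgt0// subr_gt0.
have step_ge n : (S n.+1 < S n) = (r < marginal_ratio rho C1 C2 n.+1).
  by rewrite -subr_lt0 step pmulr_rlt0// subr_lt0.
have [adm_ns ns_max] := n_s_max _ rho0.
move: adm_ns; rewrite inE /= => /andP[ns_gt0 ratio_ns].
have below n : (n.+1 < n_s rho)%N -> S n < S n.+1.
  move=> nns; rewrite step_lt (lt_le_trans _ ratio_ns)//.
  exact: marginal_ratio_lt_mono.
have above n : (n_s rho <= n)%N -> S n.+1 < S n.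
  move=> nns; rewrite step_ge ltNge; apply/negP => ratio_le.
  by have := ns_max n.+1; rewrite inE /= ratio_le ltnNge nns => /(_ isT).
have last_le : S (n_s rho).-1 <= S (n_s rho).
  by rewrite -{2}(prednK ns_gt0) leNgt step_ge prednK// -leNgt.
have incr m n : (m < n < n_s rho)%N -> S m < S n.
  move=> /andP[mn nns]; apply: lt_of_steps => // k /andP[_ kn].
  by apply: below; apply: leq_ltn_trans nns.
split.
- exact: n_s_max.
- split; first by split=> //; apply: above.
  move=> n [n_gt0 Sn_ge Sn_gt].
  case: (ltngtP (n_s rho) n) => // [ns_n|n_ns].
    have /above : (n_s rho <= n.-1)%N by rewrite -ltnS prednK.
    by rewrite prednK// ltNge Sn_ge.
  have [n1|n1] := ltnP n.+1 (n_s rho).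
    by have := lt_trans (below _ n1) Sn_gt; rewrite ltxx.
  have nE : n = (n_s rho).-1 by apply/eqP; lia.
  by move: Sn_gt; rewrite nE prednK// ltNge last_le.
- move=> m n /andP[mn]; rewrite leq_eqVlt => /orP[/eqP nE|nns]; last first.
    by left; apply: incr; rewrite mn.
  rewrite nE in mn *.
  have : (m <= (n_s rho).-1)%N by rewrite -ltnS prednK.
  rewrite leq_eqVlt => /orP[/eqP mE|m_lt]; last first.
    left; apply: lt_le_trans last_le; apply: incr; rewrite m_lt /=.
    by rewrite prednK.
  move: last_le; rewrite -mE le_eqVlt => /orP[/eqP SE|]; last by left.
  right; split=> //; apply/eqP; rewrite eq_le ratio_ns leNgt /=.
  by rewrite -(prednK ns_gt0) -step_lt prednK// -mE SE ltxx.
- move=> m n /andP[ns_m mn].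
  rewrite -ltrN2; apply: (lt_of_steps (S := fun k => - S k)) => // k.
  case/andP=> mk _.
  by rewrite ltrN2; apply: above; apply: leq_trans mk.
Qed.
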